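(* Let $k\ge 1$ be an integer and let $G$ be a graph with minimum degree $\delta(G)\ge k$. Then $G$ has a $k$-coalition partition.
   Context: All graphs are finite, simple and undirected. For an integer $k\ge 1$, a set $S\subseteq V(G)$ is a $k$-dominating set of $G$ if every vertex of $V(G)\setminus S$ has at least $k$ neighbours in $S$. Two sets $U_1,U_2\subseteq V(G)$ form a $k$-coalition (are $k$-coalition partners) if neither $U_1$ nor $U_2$ is a $k$-dominating set of $G$, but $U_1\cup U_2$ is a $k$-dominating set of $G$. A $k$-coalition partition of $G$ is a partition $\Theta$ of $V(G)$ into nonempty sets such that every set of $\Theta$ either is a $k$-dominating set of $G$ with exactly $k$ elements, or forms a $k$-coalition with some other set of $\Theta$. *)

(* Defs.v *)
(* A finite simple graph is a symmetric irreflexive relation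
   [e] on a finite type [T] of vertices. *)
From mathcomp Require Import all_boot.
Set Implicit Arguments.
Unset Strict Implicit.
Unset Printing Implicit Defensive.

Section KCoalitions.

Variables (T : finType) (e : rel T) (k : nat).
Implicit Types (S U : {set T}) (P : {set {set T}}).

Definition degree (v : T) : nat := #|[set u | e v u]|.

(* In a simple graph every degree is less than [#|T|], so the default value
   [#|T|] does not affect the minimum when there is a vertex; on the null graph
   the minimum degree is 0. *)
Definition min_degree : nat := \big[minn/#|T|]_(v : T) degree v.

Definition k_dominating S : Prop :=
  forall v, v \notin S -> k <= #|[set u in S | e v u]|.

Definition k_coalition U1 U2 : Prop :=
  [/\ ~ k_dominating U1, ~ k_dominating U2 & k_dominating (U1 :|: U2)].

(* [partition P [set: T]] includes that the blocks are nonempty. *)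
Definition k_coalition_partition P : Prop :=
  partition P [set: T] /\
  forall U, U \in P ->
    (k_dominating U /\ #|U| = k) \/
    (exists U', [/\ U' \in P, U' <> U & k_coalition U U']).

End KCoalitions.

(* Main.v *)
(** Call a k-dominating set with a single element special; the special singletons
    exist only for k = 1.  They become blocks of their own, and every other vertex is
    adjacent to all of them, so the set W of the remaining vertices, if not empty, is
    k-dominating and contains no special singleton.

    Such a set W is partitioned by induction.  Let S be a minimal k-dominating subset
    of W and s in S.  Then S :\ s and {s} are k-coalition partners.  If R = W :\: S is
    k-dominating, it is partitioned by induction.  Otherwise either {s} :|: R is
    k-dominating, and S :\ s, {s}, R are the blocks, or it is not, and S :\ s and
    {s} :|: R are k-coalition partners. *)
Require Import Defs.
From mathcomp Require Import all_boot.

Section PartitionsOfSubsets.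

Variables (T : finType) (e : rel T) (k : nat).
Implicit Types (S U W A B C R : {set T}) (P : {set {set T}}).

Lemma partitionU P1 P2 W1 W2 :
  partition P1 W1 -> partition P2 W2 -> [disjoint W1 & W2] ->
  partition (P1 :|: P2) (W1 :|: W2).
Proof.
case/and3P=> /eqP c1 t1 n1 /and3P[/eqP c2 t2 n2] dis.
apply/and3P; split.
- by rewrite /cover bigcup_setU -!/(cover _) c1 c2.
- by apply: trivIsetU => //; rewrite c1 c2.
- by rewrite inE negb_or n1 n2.
Qed.

Lemma partition_singletons W : partition [set [set v] | v in W] W.
Proof.
have [||+ _] := @indexed_partition T T (mem W) set1.
- by move=> i j _ _ ji; rewrite disjoints1 inE eq_sym.
- by move=> i _; apply/set0Pn; exists i; rewrite inE.
rewrite cover_imset; congr (partition _ _).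
apply/setP=> x; apply/bigcupP/idP => [[v vW]|xW]; first by rewrite inE => /eqP->.
by exists x; rewrite ?inE.
Qed.

Definition dominatingb S :=
  [forall v, (v \notin S) ==> (k <= #|[set u in S | e v u]|)].

Lemma dominatingP S : reflect (k_dominating e k S) (dominatingb S).
Proof.
apply: (iffP forallP) => [h v vS|h v]; first exact: implyP (h v) vS.
by apply/implyP; apply: h.
Qed.

(** A vertex outside [S] already has [k] neighbours in [S]; if there is none, [S] is all of [T]. *)
Lemma leq_card_dominating S : k <= #|T| -> k_dominating e k S -> k <= #|S|.
Proof.
move=> kT domS; have [->|SnT] := eqVneq S [set: T]; first by rewrite cardsT.
have /properP[_ [v _ vS]] : S \proper [set: T] by rewrite properT.
by apply: leq_trans (domS v vS) (subset_leq_card _); apply/subsetP=> u /setIdP[].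
Qed.

Lemma min_degree_leq_card : min_degree e <= #|T|.
Proof.
rewrite /min_degree; elim/big_ind: _ => // [x y hx _|v _]; last exact: max_card.
by rewrite geq_min hx.
Qed.

(** Only [W] is partitioned, but domination still refers to the whole graph; hence such partitions
    of disjoint sets can be merged. *)
Definition coalition_partition_on W P :=
  partition P W /\
  forall U, U \in P ->
    (k_dominating e k U /\ #|U| = k) \/
    (exists U', [/\ U' \in P, U' <> U & k_coalition e k U U']).

Lemma coalition_partition_onU P1 P2 W1 W2 :
  coalition_partition_on W1 P1 -> coalition_partition_on W2 P2 ->
  [disjoint W1 & W2] -> coalition_partition_on (W1 :|: W2) (P1 :|: P2).
Proof.
move=> [p1 h1] [p2 h2] dis; split; first exact: partitionU.
move=> U /setUP[/h1|/h2] [|[U' [U'P nU cU]]]; try by left.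
  by right; exists U'; rewrite inE U'P.
by right; exists U'; rewrite inE U'P orbT.
Qed.

Lemma k_coalitionC A B : k_coalition e k A B -> k_coalition e k B A.
Proof. by case=> nA nB dAB; split=> //; rewrite setUC. Qed.

Lemma k_coalition_neq0 A B : k_coalition e k A B -> A != set0.
Proof. by case=> _ nB dAB; apply/eqP=> A0; rewrite A0 set0U in dAB. Qed.

Lemma k_coalition_neq A B : k_coalition e k A B -> A <> B.
Proof. by case=> nA _ dAB AB; rewrite -AB setUid in dAB. Qed.

Lemma coalition_partition_on2 A B :
  [disjoint A & B] -> k_coalition e k A B ->
  coalition_partition_on (A :|: B) [set A; B].
Proof.
move=> dis cAB; have cBA := k_coalitionC _ _ cAB; split.
  have pB : partition [set B] B.
    by rewrite /partition cover1 eqxx trivIset1 inE eq_sym (k_coalition_neq0 _ _ cBA).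
  exact: partitionU1 pB (k_coalition_neq0 _ _ cAB) dis.
move=> U; rewrite !inE => /orP[] /eqP->; right.
  by exists B; split=> //; [rewrite !inE eqxx orbT | exact: k_coalition_neq cBA].
by exists A; split=> //; [rewrite !inE eqxx | exact: k_coalition_neq cAB].
Qed.

(** The old blocks keep their partners, and [U] may serve as partner of several blocks. *)
Lemma coalition_partition_onU1 C U P W :
  coalition_partition_on W P -> U \in P -> [disjoint C & W] ->
  k_coalition e k C U -> coalition_partition_on (C :|: W) (C |: P).
Proof.
move=> [pP hP] UP dis cCU; split.
  exact: partitionU1 pP (k_coalition_neq0 _ _ cCU) dis.
move=> X /setU1P[->|/hP[|[Y [YP nXY cXY]]]]; [right|by left|right].
  by exists U; split; [rewrite !inE UP orbT | apply/nesym/k_coalition_neq | ].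
by exists Y; rewrite !inE YP orbT.
Qed.

(** The condition on singletons passes to subsets of [W], so it survives the induction on [#|W|]. *)
Lemma coalition_partition_on_dominating W :
  k <= #|T| -> 0 < k -> k_dominating e k W ->
  (forall v, v \in W -> ~ k_dominating e k [set v]) ->
  exists P, coalition_partition_on W P.
Proof.
move=> kT k0; have [n] := ubnP #|W|; elim: n W => // n IHn W ltWn domW nsing.
have [S minS sSW] := minset_exists (introT (dominatingP W) domW).
have /minsetP[/dominatingP domS Smin] := minS.
have /card_gt0P[s sS] : 0 < #|S| := leq_trans k0 (leq_card_dominating _ kT domS).
have defS : (S :\ s) :|: [set s] = S by rewrite setUC setD1K.
have disS : [disjoint S :\ s & [set s]] by rewrite disjoint_sym disjoints1 !inE eqxx.
have nB : ~ k_dominating e k [set s] := nsing s (subsetP sSW _ sS).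
(* By minimality a k-dominating [S :\ s] would equal [S], yet it misses [s]. *)
have nA : ~ k_dominating e k (S :\ s).
  move=> /dominatingP/Smin/(_ (subsetDl _ _))/setP/(_ s).
  by rewrite !inE eqxx sS.
have cAB : k_coalition e k (S :\ s) [set s] by split=> //; rewrite defS.
have gAB := coalition_partition_on2 _ _ disS cAB; rewrite defS in gAB.
have defW : S :|: (W :\: S) = W by rewrite -{1}(setIidPr sSW) setID.
have disW : [disjoint S & W :\: S] by rewrite -setI_eq0 setIDA setDIl setDv set0I.
have [/dominatingP domR|/dominatingP nR] := boolP (dominatingb (W :\: S)).
  have [||v /setDP[vW _]|Q gQ] := IHn (W :\: S); [|by []|exact: nsing|].
    apply: leq_trans (_ : #|W| <= n); last by rewrite -ltnS.
    apply: proper_card; apply/properP; split; first exact: subsetDl.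
    by exists s; [exact: (subsetP sSW) | rewrite inE sS].
  by exists ([set S :\ s; [set s]] :|: Q); rewrite -defW; apply: coalition_partition_onU.
have [/dominatingP domBR|/dominatingP nBR] := boolP (dominatingb ([set s] :|: (W :\: S))).
  (* Here [[set s]] is the partner of both other blocks. *)
  exists ((W :\: S) |: [set S :\ s; [set s]]).
  rewrite -[X in coalition_partition_on X _]defW setUC.
  apply: (coalition_partition_onU1 _ [set s]) => //; first by rewrite !inE eqxx orbT.
    by rewrite disjoint_sym.
  by split=> //; rewrite setUC.
(* The union of the two blocks is [W], k-dominating by assumption. *)
exists [set S :\ s; [set s] :|: (W :\: S)].
rewrite -[X in coalition_partition_on X _]defW -{1}defS -setUA.
apply: coalition_partition_on2; last by split=> //; rewrite setUA defS defW.
by rewrite -setI_eq0 setIUr setU_eq0 !setI_eq0 disS (disjointWl (subsetDl _ _)).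
Qed.

End PartitionsOfSubsets.

Theorem theorem1 (T : finType) (e : rel T) (k : nat)
    (e_sym : symmetric e) (e_irr : irreflexive e)
    (hk : 1 <= k) (hdeg : k <= min_degree e) :
  exists P : {set {set T}}, k_coalition_partition e k P.
Proof.
have kT : k <= #|T| := leq_trans hdeg (min_degree_leq_card _ e).
pose F := [set v | dominatingb T e k [set v]].
have domF v : v \in F -> k_dominating e k [set v] by rewrite inE => /dominatingP.
have gF : coalition_partition_on T e k F [set [set v] | v in F].
  split; first exact: partition_singletons.
  move=> _ /imsetP[v /domF domv ->]; left; split=> //.
  by apply/eqP; rewrite eqn_leq (leq_card_dominating _ _ _ _ kT domv) cards1 hk.
have [Q gQ] : exists Q, coalition_partition_on T e k (~: F) Q.
  (* The empty set need not be k-dominating, so it is treated apart, with no blocks. *)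
  have [F0|/set0Pn[w wF]] := eqVneq (~: F) set0.
    exists set0; rewrite F0; split; first by rewrite partition_set0.
    by move=> U; rewrite inE.
  apply: coalition_partition_on_dominating => //; last first.
    by move=> v; rewrite !inE => /dominatingP.
  move=> v; rewrite inE negbK => vF; have domv := domF v vF.
  have k1 : k <= 1 by rewrite -(cards1 v); apply: leq_card_dominating domv.
  (* Since [k <= 1], one neighbour of [v] outside [F] suffices. The vertex [w] is one: it must have
     a neighbour in [[set v]], which can only be [v]. *)
  apply: leq_trans k1 _; apply/card_gt0P; exists w; rewrite inE wF e_sym /=.
  have wv : w \notin [set v].
    by apply: contraTN wF => /set1P->; rewrite inE negbK.
  have /card_gt0P[u] := leq_trans hk (domv w wv).
  by rewrite !inE => /andP[/eqP->].
exists ([set [set v] | v in F] :|: Q); rewrite /k_coalition_partition -(setUCr F).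
by apply: coalition_partition_onU => //; rewrite -setI_eq0 setICr.
Qed.
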